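(* The mean multiplicity of the eigenvalue $0$ of the random recursive tree $\mathcal{R}_n$ with $n$ vertices satisfies, as $n\to\infty$, \[\mathbb{E}(N_0(\mathcal{R}_n)) = (2G-1)\,n + \mathcal{O}\Big(\frac{1}{\log n}\Big),\] where $G=\int_0^1 \frac{1}{1-\log(1-u)}\,du$ is the Euler–Gompertz constant.
   Context: A recursive tree with $n$ vertices is a rooted (unordered) tree with vertex labels $1,\dots,n$, each used once, whose labels increase along every path starting at the root. There are $(n-1)!$ of them, and the random recursive tree $\mathcal{R}_n$ is uniformly distributed among them. $N_0(T)$ is the multiplicity of $0$ as an eigenvalue of the adjacency matrix of the underlying undirected graph of $T$. $\mathbb{E}$ denotes expectation. *)

(* Defs.v *)
From mathcomp Require Import all_boot all_order all_algebra.
From mathcomp Require Import all_classical all_reals all_analysis.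

Set Implicit Arguments.
Unset Strict Implicit.
Unset Printing Implicit Defensive.

Import Order.TTheory GRing.Theory Num.Theory numFieldNormedType.Exports.
Local Open Scope ring_scope.
Local Open Scope classical_set_scope.

Section Graphs.
Variable V : finType.

(* An undirected graph is given by its set of ordered adjacent pairs. *)
Definition adj (E : {set V * V}) : rel V := fun u v => (u, v) \in E.

Definition simple_graph (E : {set V * V}) : Prop :=
  symmetric (adj E) /\ irreflexive (adj E).

Definition connected_graph (E : {set V * V}) : Prop :=
  forall u v : V, connect (adj E) u v.

(* The size bound rules out the closed walk u, v, u along a single edge. *)
Definition acyclic_graph (E : {set V * V}) : Prop :=
  forall c : seq V, (2 < size c)%N -> ~ ucycle (adj E) c.

Definition is_tree (E : {set V * V}) : Prop :=
  [/\ simple_graph E, connected_graph E & acyclic_graph E].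

End Graphs.

(* Vertices are identified with their labels; 'I_n starts at 0, labels at 1. *)
Definition label (n : nat) (v : 'I_n) : nat := v.+1.

(* A labelled rooted tree is a pair (root, edges). *)
Definition is_recursive_tree (n : nat) (T : 'I_n * {set 'I_n * 'I_n}) : Prop :=
  is_tree T.2 /\
  forall s : seq 'I_n, path (adj T.2) T.1 s -> uniq (T.1 :: s) ->
    sorted ltn [seq label v | v <- T.1 :: s].

Definition recursive_trees (n : nat) : {set 'I_n * {set 'I_n * 'I_n}} :=
  [set T | `[< is_recursive_tree T >]]%SET.

Definition adjacency_matrix (R : realType) (n : nat) (E : {set 'I_n * 'I_n}) :
  'M[R]_n := \matrix_(i, j) (adj E i j)%:R.

Definition N0 (R : realType) (n : nat) (T : 'I_n * {set 'I_n * 'I_n}) : nat :=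
  mup 0 (char_poly (adjacency_matrix R T.2)).

(* Expectation under the uniform distribution on recursive trees. *)
Definition mean_N0 (R : realType) (n : nat) : R :=
  (\sum_(T in recursive_trees n) (N0 R T)%:R) / #|recursive_trees n|%:R.

(* u = 1 is left out because the integrand takes a junk value there (ln 0 = 0). *)
Definition euler_gompertz (R : realType) : R :=
  Rintegral lebesgue_measure `[0%R, 1%R[ (fun u : R => 1 / (1 - ln (1 - u))).

(* Main.v *)
Require Import Defs.
From mathcomp Require Import all_boot all_order all_algebra.
From mathcomp Require Import all_classical all_reals all_analysis measurable_realfun.
From mathcomp Require Import zify ring lra.

Import Order.TTheory GRing.Theory Num.Theory numFieldNormedType.Exports.
Local Open Scope ring_scope.
Local Open Scope classical_set_scope.
Set Implicit Arguments.
Unset Strict Implicit.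
Unset Printing Implicit Defensive.

(** A maximum matching of a rooted tree is found greedily from the leaves to the
    root.  Gaussian elimination in the same order shows that [det (x - A)] behaves
    like a constant times [x ^ (f - c)] as [x -> 0+], where [c] vertices are
    matched to one of their children and the [f] others are free, so that the
    multiplicity of [0] is [f - c].

    A random recursive tree splits at the oldest child of its root into two
    independent random recursive trees of uniformly distributed sizes.  Hence the
    probability [q m] that the root of the tree on [m + 1] vertices is free has
    generating function [1 / ((1 - x) (1 - ln (1 - x)))], and the mean of [f - c]
    is [2 (q m) - (m + 1) + 2 (m + 1) sum_(k < m) q k / ((k + 1) (k + 2))].
    Integrating [(1 - x) sum_k q k x ^ k = 1 / (1 - ln (1 - x))] over [0, 1] shows
    that the sum converges to the Euler-Gompertz constant; as [q k = O(1 / ln k)],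
    its tail, multiplied by [m + 1], is [O(1 / ln m)]. *)

(** * Plane encoding of recursive trees *)

(* [Node a b] is the tree in which [b] hangs from the oldest child of the root
   and [a] is what remains after removing it, so the root is the leftmost leaf. *)
Inductive tree := Leaf of nat | Node of tree & tree.

Fixpoint vertices (t : tree) : seq nat :=
  match t with Leaf v => [:: v] | Node a b => vertices a ++ vertices b end.

(** The enclosing nodes have already split off the earlier children of [u], so replacing the leaf
    [u] makes [w] its youngest child. *)
Fixpoint insert (u w : nat) (t : tree) : tree :=
  match t with
  | Leaf v => if v == u then Node (Leaf v) (Leaf w) else Leaf v
  | Node a b => Node (insert u w a) (insert u w b)
  end.

Fixpoint shape (t : tree) : tree :=
  match t with Leaf _ => Leaf 0 | Node a b => Node (shape a) (shape b) end.

Fixpoint grow (t : tree) : seq tree :=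
  match t with
  | Leaf v => [:: Node (Leaf v) (Leaf 0)]
  | Node a b => map (Node^~ b) (grow a) ++ map (Node a) (grow b)
  end.

(** Repetitions are kept: there is one entry per recursive tree on [n + 1] vertices, so that summing
    over the list reflects the uniform distribution. *)
Fixpoint shapes (n : nat) : seq tree :=
  if n is m.+1 then flatten (map grow (shapes m)) else [:: Leaf 0].

(* A vertex is free if [tau] says so initially and none of its children is
   free: these are the vertices which the leaf-to-root greedy maximum matching
   does not match with one of their children. *)
Fixpoint free_root (tau : nat -> bool) (t : tree) : bool :=
  match t with
  | Leaf v => tau v
  | Node a b => free_root tau a && ~~ free_root tau b
  end.

(* The number of free vertices minus the number of the others; a free root
   stops being free when a free [b] is hung from it, hence the correction. *)
Fixpoint surplus (tau : nat -> bool) (t : tree) : int :=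
  match t with
  | Leaf v => if tau v then 1 else -1
  | Node a b => surplus tau a + surplus tau b
                - (free_root tau a && free_root tau b)%:R *+ 2
  end.

(** The effect of pruning a leaf [w] hung from [u]: if [w] is free, it is matched with [u], which is
    then no longer free. *)
Definition settle (tau : nat -> bool) (u w : nat) : nat -> bool :=
  if tau w then fun v => tau v && (v != u) else tau.

Lemma insert_notin u w t : u \notin vertices t -> insert u w t = t.
Proof.
elim: t => [v|a IHa b IHb] /=; first by rewrite inE eq_sym => /negPf ->.
by rewrite mem_cat negb_or => /andP[/IHa -> /IHb ->].
Qed.

Lemma free_root_ext tau tau' t : {in vertices t, tau =1 tau'} ->
  free_root tau t = free_root tau' t.
Proof.
elim: t => [v|a IHa b IHb] /= h; first by apply: h; rewrite inE.
by rewrite IHa ?IHb // => v hv; apply: h; rewrite mem_cat hv ?orbT.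
Qed.

Lemma surplus_ext tau tau' t : {in vertices t, tau =1 tau'} ->
  surplus tau t = surplus tau' t.
Proof.
elim: t => [v|a IHa b IHb] /= h; first by rewrite h // inE.
have ha : {in vertices a, tau =1 tau'} by move=> v hv; apply: h; rewrite mem_cat hv.
have hb : {in vertices b, tau =1 tau'}.
  by move=> v hv; apply: h; rewrite mem_cat hv orbT.
by rewrite IHa ?IHb // !(free_root_ext ha, free_root_ext hb).
Qed.

Lemma settle_notin tau u w (s : seq nat) : u \notin s ->
  {in s, settle tau u w =1 tau}.
Proof.
move=> us v vs; rewrite /settle; case: ifP => // _.
by case: eqP => [vu|_]; [rewrite -vu vs in us|rewrite andbT].
Qed.

Lemma free_root_insert tau u w t : uniq (vertices t) ->
  u \in vertices t -> free_root tau (insert u w t) = free_root (settle tau u w) t.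
Proof.
elim: t => [v|a IHa b IHb] /= => [_|].
  rewrite inE => /eqP ->; rewrite eqxx /= /settle.
  by case: (tau w); rewrite ?eqxx ?andbF ?andbT.
rewrite cat_uniq mem_cat => /and3P[ua dab ub]; case: (boolP (u \in vertices a)).
  move=> hua _; have hub : u \notin vertices b.
    by apply: contra dab => hub; apply/hasP; exists u.
  by rewrite (insert_notin _ hub) IHa // (free_root_ext (settle_notin tau w hub)).
move=> hua /= hub.
by rewrite (insert_notin _ hua) IHb // (free_root_ext (settle_notin tau w hua)).
Qed.

(** The new leaf has no children, so its status is final; it can be counted separately and removed
    once its effect on [u] is recorded. This mirrors one step of the elimination. *)
Lemma surplus_insert tau u w t : uniq (vertices t) ->
  u \in vertices t ->
  surplus tau (insert u w t) =
  (if tau w then 1 else -1) + surplus (settle tau u w) t.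
Proof.
elim: t => [v|a IHa b IHb] /= => [_|].
  rewrite inE => /eqP ->; rewrite eqxx /= /settle.
  by case: (tau w); case: (tau v); rewrite /= ?eqxx /=; lia.
rewrite cat_uniq mem_cat => /and3P[ua dab ub]; case: (boolP (u \in vertices a)).
  move=> hua _; have hub : u \notin vertices b.
    by apply: contra dab => hub; apply/hasP; exists u.
  rewrite (insert_notin _ hub) IHa // free_root_insert //.
  rewrite (free_root_ext (settle_notin tau w hub)).
  by rewrite (surplus_ext (settle_notin tau w hub)) !addrA.
move=> hua /= hub.
rewrite (insert_notin _ hua) IHb // free_root_insert //.
rewrite (free_root_ext (settle_notin tau w hua)).
by rewrite (surplus_ext (settle_notin tau w hua)) addrCA !addrA.
Qed.

Lemma free_root_shape t : free_root xpredT (shape t) = free_root xpredT t.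
Proof. by elim: t => //= a -> b ->. Qed.

Lemma surplus_shape t : surplus xpredT (shape t) = surplus xpredT t.
Proof. by elim: t => //= a -> b ->; rewrite !free_root_shape. Qed.

(** As the labels are distinct, each [u] designates exactly one leaf of [t], hence one growth
    position of its shape. *)
Lemma sum_grow (R : nmodType) (F : tree -> R) t w : uniq (vertices t) ->
  \sum_(u <- vertices t) F (shape (insert u w t)) =
  \sum_(t' <- grow (shape t)) F t'.
Proof.
elim: t F => [v|a IHa b IHb] F /=; first by rewrite !big_seq1 eqxx.
rewrite cat_uniq => /and3P[ua dab ub]; rewrite !big_cat !big_map /=; congr (_ + _).
  rewrite -(IHa (fun t => F (Node t (shape b)))) //; apply: eq_big_seq => u ha.
  by rewrite (@insert_notin u w b) //; apply: contra dab => hb; apply/hasP; exists u.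
rewrite -(IHb (fun t => F (Node (shape a) t))) //; apply: eq_big_seq => u hb.
by rewrite (@insert_notin u w a) //; apply: contra dab => ha; apply/hasP; exists u.
Qed.

(* A recursive tree on [0, ..., n] is encoded by the list of the parents of its
   vertices [n, ..., 1], in this order. *)
Fixpoint parent_lists (n : nat) : seq (seq nat) :=
  if n is m.+1 then [seq u :: s | s <- parent_lists m, u <- iota 0 n]
  else [:: [::]].

Fixpoint tree_of (s : seq nat) : tree :=
  if s is u :: s' then insert u (size s) (tree_of s') else Leaf 0.

Lemma parent_listsP n u s : (u :: s \in parent_lists n.+1) =
  (u <= n)%N && (s \in parent_lists n).
Proof.
apply/allpairsP/andP => [[[s' u'] [hs hu [-> ->]]]|[hu hs]].
  split; last exact: hs; by move: hu; rewrite mem_iota add0n ltnS => /andP[_].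
by exists (s, u); split => //; rewrite mem_iota add0n ltnS.
Qed.

Lemma parent_lists0 n : [::] \in parent_lists n.+1 = false.
Proof. by apply/negP => /allpairsP[[s u] /= [_ _]]. Qed.

Lemma size_parent_lists n s : s \in parent_lists n -> size s = n.
Proof.
elim: n s => [|n IHn] [|u s] //; rewrite ?parent_lists0 //.
by rewrite parent_listsP => /andP[_ /IHn /= ->].
Qed.

Lemma parent_lists_uniq n : uniq (parent_lists n).
Proof.
elim: n => // n IHn; apply: allpairs_uniq => //; first exact: iota_uniq.
by move=> [s u] [s' u'] _ _ /= [-> ->].
Qed.

Lemma perm_vertices_insert u w t : uniq (vertices t) -> u \in vertices t ->
  perm_eq (vertices (insert u w t)) (rcons (vertices t) w).
Proof.
elim: t => [v|a IHa b IHb] /= => [_|].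
  by rewrite inE => /eqP ->; rewrite eqxx.
rewrite cat_uniq mem_cat => /and3P[ua dab ub]; case: (boolP (u \in vertices a)).
  move=> hua _; have hub : u \notin vertices b.
    by apply: contra dab => hub; apply/hasP; exists u.
  rewrite (insert_notin _ hub) -!cats1 -catA perm_sym.
  rewrite (perm_catl _ (permEl (perm_catC _ _))) catA perm_sym.
  by rewrite perm_cat2r cats1 IHa.
move=> hua /= hub; rewrite (insert_notin _ hua) rcons_cat perm_cat2l.
exact: IHb.
Qed.

Lemma perm_vertices_tree_of n s : s \in parent_lists n ->
  perm_eq (vertices (tree_of s)) (iota 0 n.+1).
Proof.
elim: n s => [|n IHn] [|u s] //; rewrite ?parent_lists0 //.
rewrite parent_listsP => /andP[un hs] /=.
have hp := IHn s hs; have hu := perm_uniq hp.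
rewrite iota_uniq in hu.
have us : u \in vertices (tree_of s) by rewrite (perm_mem hp) mem_iota add0n ltnS.
rewrite (perm_trans (perm_vertices_insert _ hu us)) //.
rewrite (size_parent_lists hs) -[0%N :: _]/(iota 0 n.+2) -[n.+2]addn1 iotaD.
by rewrite add0n cats1 -!cats1 perm_cat2r.
Qed.

Lemma sum_parent_lists (R : nmodType) (F : tree -> R) n :
  \sum_(s <- parent_lists n) F (shape (tree_of s)) = \sum_(t <- shapes n) F t.
Proof.
elim: n F => [|n IHn] F; first by rewrite !big_seq1.
rewrite big_allpairs_dep big_flatten big_map -IHn; apply: eq_big_seq => s hs /=.
have hp := perm_vertices_tree_of hs; have hu := perm_uniq hp.
rewrite iota_uniq in hu.
by rewrite -(sum_grow _ (size s).+1 hu) (perm_big _ hp).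
Qed.

(** * Averages over random recursive trees and recurrences for the means *)

Section Averages.
Variable R : realType.
Implicit Type F : tree -> R.

Definition avg n F : R := (\sum_(t <- shapes n) F t) / n`!%:R.

Lemma eq_avg n F F' : F =1 F' -> avg n F = avg n F'.
Proof. by move=> h; congr (_ / _); apply: eq_bigr. Qed.

Lemma avg0 F : avg 0 F = F (Leaf 0).
Proof. by rewrite /avg big_seq1 divr1. Qed.

Lemma avgD n F F' : avg n (fun t => F t + F' t) = avg n F + avg n F'.
Proof. by rewrite /avg big_split mulrDl. Qed.

Lemma avgZ n c F : avg n (fun t => c * F t) = c * avg n F.
Proof. by rewrite /avg -mulr_sumr mulrA. Qed.

Lemma avgS n F :
  avg n.+1 F = (n.+1%:R)^-1 * avg n (fun t => \sum_(t' <- grow t) F t').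
Proof.
rewrite /avg big_flatten big_map mulrCA factS natrM invfM.
by congr (_ * _); rewrite mulrC.
Qed.

Lemma avg_sum n (I : Type) (r : seq I) (F : I -> tree -> R) :
  avg n (fun t => \sum_(i <- r) F i t) = \sum_(i <- r) avg n (F i).
Proof. by rewrite /avg exchange_big mulr_suml. Qed.

(* A uniform recursive tree splits at the oldest child of its root into two
   independent uniform recursive trees, whose sizes are uniformly distributed. *)
Lemma avg_split n F : n.+1%:R * avg n.+1 F =
  \sum_(j < n.+1) avg (n - j) (fun a => avg j (fun b => F (Node a b))).
Proof.
elim: n F => [|n IHn] F.
  by rewrite big_ord_recl big_ord0 addr0 !avg0 mul1r avgS invr1 mul1r avg0 big_seq1.
rewrite avgS mulrA divff ?mul1r ?pnatr_eq0 //.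
apply: (mulfI (_ : n.+1%:R != 0)); first by rewrite pnatr_eq0.
rewrite IHn.
set H := fun j : nat => avg (n.+1 - j) (fun a => avg j (fun b => F (Node a b))).
(* A new vertex attaches to one of the [n - j + 1] vertices of the first part or of the [j + 1] of
   the second. Regrouped by the resulting split, each [H j] receives total weight [n + 1]. *)
rewrite (eq_bigr (fun j : 'I_n.+1 => (n.+1 - j)%:R * H j + j.+1%:R * H j.+1)).
  rewrite big_split /= mulr_sumr.
  have -> : \sum_(j < n.+1) j.+1%:R * H j.+1 = \sum_(j < n.+2) j%:R * H j.
    by rewrite [RHS]big_ord_recl mul0r add0r.
  have -> : \sum_(j < n.+1) (n.+1 - j)%:R * H j = \sum_(j < n.+2) (n.+1 - j)%:R * H j.
    by rewrite [RHS]big_ord_recr /= subnn mul0r addr0.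
  rewrite -big_split; apply: eq_bigr => j _ /=.
  by rewrite -mulrDl -natrD subnK // -ltnS.
move=> j _; have jn : (j <= n)%N by rewrite -ltnS.
rewrite /H subSS subSn // avgS mulrA divff ?mul1r ?pnatr_eq0 //.
rewrite -avgZ -avgD; apply: eq_avg => a.
rewrite (eq_avg _ (F' := fun b => \sum_(a' <- grow a) F (Node a' b) +
   \sum_(b' <- grow b) F (Node a b'))).
  by rewrite avgD avg_sum avgS mulrA divff ?mul1r ?pnatr_eq0.
by move=> b /=; rewrite big_cat !big_map.
Qed.

(** For [c = 1] this says that [shapes n] has [n!] entries, so that [avg] is a genuine mean. *)
Lemma avg_cst n (c : R) : avg n (fun=> c) = c.
Proof.
elim/ltn_ind: n => [[|n]] IH; first by rewrite avg0.
apply: (mulfI (_ : n.+1%:R != 0)); first by rewrite pnatr_eq0.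
rewrite avg_split (eq_bigr (fun=> c)) => [|j _].
  by rewrite sumr_const card_ord mulr_natl.
by rewrite (eq_avg _ (F' := fun=> c)) ?IH // ?ltnS ?leq_subr // => a; rewrite IH.
Qed.

Lemma avgM m n F F' :
  avg m (fun a => avg n (fun b => F a * F' b)) = avg m F * avg n F'.
Proof.
under eq_avg do rewrite avgZ mulrC.
by rewrite avgZ mulrC.
Qed.

(* Index [n] stands for trees on [n + 1] vertices. *)
Definition root_prob n : R := avg n (fun t => (free_root xpredT t)%:R).

Definition mean_surplus n : R := avg n (fun t => (surplus xpredT t)%:~R).

Lemma root_prob_split n : n.+1%:R * root_prob n.+1 =
  \sum_(j < n.+1) root_prob (n - j) * (1 - root_prob j).
Proof.
rewrite avg_split; apply: eq_bigr => j _ /=.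
have -> : 1 - root_prob j = avg j (fun b => 1 + -1 * (free_root xpredT b)%:R).
  by rewrite avgD avgZ avg_cst mulN1r.
rewrite -avgM; apply: eq_avg => a; apply: eq_avg => b.
case: (free_root _ a); case: (free_root _ b) => /=; lra.
Qed.

Lemma mean_surplus_split n : n.+1%:R * mean_surplus n.+1 =
  \sum_(j < n.+1) (mean_surplus (n - j) + mean_surplus j
                   - 2 * (root_prob (n - j) * root_prob j)).
Proof.
rewrite avg_split; apply: eq_bigr => j _ /=.
rewrite -avgM -mulNr -avgZ -[mean_surplus j](avg_cst (n - j)) -!avgD.
apply: eq_avg => a.
rewrite -[(surplus _ a)%:~R in RHS](avg_cst j) -avgZ -!avgD.
apply: eq_avg => b; rewrite rmorphB rmorphD /=.
case: (free_root _ a); case: (free_root _ b) => /=; rewrite ?mulr0n; lra.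
Qed.

Lemma root_prob0 : root_prob 0 = 1.
Proof. by rewrite /root_prob avg0. Qed.

Lemma root_prob_ge0 n : 0 <= root_prob n.
Proof. by rewrite divr_ge0 // sumr_ge0. Qed.

Lemma root_prob_le1 n : root_prob n <= 1.
Proof.
rewrite -[X in _ <= X](avg_cst n) ler_wpM2r // ?invr_ge0 //.
by apply: ler_sum => t _; case: free_root.
Qed.

(** The splitting identity involves all earlier means; subtracting two consecutive instances of it
    leaves a first-order recurrence. *)
Lemma mean_surplusS n : n.+1%:R * mean_surplus n.+1 =
  n.+2%:R * mean_surplus n + 2 * n.+1%:R * (root_prob n.+1 - root_prob n).
Proof.
(* The quadratic terms [q (k - j) * q j] are eliminated by [root_prob_split], and reversing [j]
   merges the two halves of each sum. *)
have E k : k.+1%:R * mean_surplus k.+1 =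
    2 * (\sum_(j < k.+1) (mean_surplus j - root_prob j)) + 2 * k.+1%:R * root_prob k.+1.
  rewrite -mulrA root_prob_split mean_surplus_split -mulrDr.
  rewrite -big_split /= mulr_sumr.
  pose f (j : nat) := mean_surplus (k - j) - root_prob (k - j).
  pose g (j : nat) := mean_surplus j - root_prob j.
  have fg : \sum_(j < k.+1) f j = \sum_(j < k.+1) g j.
    rewrite (reindex_inj rev_ord_inj) /=; apply: eq_bigr => j _.
    by rewrite /f /g /= subSS subKn // -ltnS.
  transitivity (\sum_(j < k.+1) (f j + g j)
     + \sum_(j < k.+1) (root_prob (k - j) + root_prob j
     - 2 * (root_prob (k - j) * root_prob j))).
    by rewrite -big_split; apply: eq_bigr => j _ /=; rewrite /f /g; ring.
  rewrite big_split /= fg -big_split -big_split /=.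
  have rr : \sum_(j < k.+1) root_prob j = \sum_(j < k.+1) root_prob (k - j).
    rewrite [RHS](reindex_inj rev_ord_inj) /=; apply: eq_bigr => j _.
    by rewrite subSS subKn // -ltnS.
  transitivity (\sum_(j < k.+1) (2 * g j + 2 * root_prob (k - j) 
     - 2 * (root_prob (k - j) * root_prob j)) + 
    (\sum_(j < k.+1) root_prob j - \sum_(j < k.+1) root_prob (k - j))).
    rewrite -sumrB -big_split; apply: eq_bigr => j _ /=; ring.
  rewrite rr subrr addr0; apply: eq_bigr => j _; rewrite /g; ring.
case: n => [|n].
  rewrite E big_ord_recr big_ord0 /= /mean_surplus avg0 root_prob0; ring.
rewrite E big_ord_recr /= mulrDr.
have -> : 2 * \sum_(j < n.+1) (mean_surplus j - root_prob j) =
  n.+1%:R * mean_surplus n.+1 - 2 * n.+1%:R * root_prob n.+1 by rewrite E; ring.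
rewrite -[n.+3]addn1 -[n.+2]addn1 !natrD; ring.
Qed.

(** Divided by [(n + 1) (n + 2)], the recurrence telescopes; summation by parts turns the increments
    of [root_prob] into the weights [1 / ((k + 1) (k + 2))]. Induction confirms the closed form. *)
Lemma mean_surplusE n : mean_surplus n = 2 * root_prob n - n.+1%:R
  + 2 * n.+1%:R * \sum_(k < n) root_prob k / (k.+1%:R * k.+2%:R).
Proof.
elim: n => [|n IHn].
  by rewrite big_ord0 root_prob0 /mean_surplus avg0; lra.
apply: (mulfI (_ : n.+1%:R != 0)); first by rewrite pnatr_eq0.
rewrite mean_surplusS IHn big_ord_recr /=.
set S := \sum_(_ < _) _; rewrite -[n.+2]addn1 -[n.+1]addn1 !natrD.
have n1 : n%:R + 1 != 0 :> R by rewrite natr1 pnatr_eq0.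
have n2 : n%:R + 1 + 1 != 0 :> R by rewrite !natr1 pnatr_eq0.
by field; rewrite n1 n2.
Qed.

End Averages.

(** * Recursive trees and parent lists *)

(** The list runs from the parent of [n] down to that of [1]. At [v = 0] the index is out of range
    and [nth] returns the default 0, whence the guards in [edges]. *)
Definition parent (s : seq nat) (v : nat) : nat := nth 0%N s (size s - v).

Definition edges (n : nat) (s : seq nat) : {set 'I_n * 'I_n} :=
  [set e : 'I_n * 'I_n | (0 < e.2)%N && (parent s e.2 == e.1)
                      || (0 < e.1)%N && (parent s e.1 == e.2)]%SET.

Lemma parent_cons u s v : (v <= size s)%N -> parent (u :: s) v = parent s v.
Proof. by move=> vs; rewrite /parent /= subSn. Qed.

Lemma parent_last n u s : size s = n -> parent (u :: s) n.+1 = u.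
Proof. by move=> <-; rewrite /parent /= subnn. Qed.

Lemma parent_lt n s v : s \in parent_lists n -> (0 < v <= n)%N ->
  (parent s v < v)%N.
Proof.
elim: n s => [|n IHn] [|u s]; rewrite ?parent_lists0 //; first by case: v.
rewrite parent_listsP => /andP[un hs] /andP[v0].
have sz := size_parent_lists hs; rewrite leq_eqVlt ltnS => /orP[/eqP ->|vn].
  by rewrite (parent_last _ sz) ltnS.
by rewrite parent_cons ?sz // IHn // v0.
Qed.

Lemma parent_list_exists n (p : nat -> nat) :
  (forall v, (0 < v <= n)%N -> (p v < v)%N) ->
  exists2 s, s \in parent_lists n & forall v, (0 < v <= n)%N -> parent s v = p v.
Proof.
elim: n => [|n IHn] hp; first by exists [::] => // -[].
have [v /andP[v0 vn]|s hs ps] := IHn; first by rewrite hp // v0 leqW.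
exists (p n.+1 :: s); first by rewrite parent_listsP hs andbT -ltnS hp /=.
have sz := size_parent_lists hs.
move=> v /andP[v0]; rewrite leq_eqVlt ltnS => /orP[/eqP ->|vn].
  by rewrite (parent_last _ sz).
by rewrite parent_cons ?sz // ps // v0.
Qed.

Lemma parent_inj n s s' : s \in parent_lists n -> s' \in parent_lists n ->
  (forall v, (0 < v <= n)%N -> parent s v = parent s' v) -> s = s'.
Proof.
elim: n s s' => [|n IHn] [|u s] [|u' s']; rewrite ?parent_lists0 //.
rewrite !parent_listsP => /andP[_ hs] /andP[_ hs'] h.
have [sz sz'] := (size_parent_lists hs, size_parent_lists hs').
congr (_ :: _).
  by have := h n.+1 (leqnn _); rewrite (parent_last _ sz) (parent_last _ sz').
apply: IHn => // v /andP[v0 vn].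
by have := h v; rewrite !parent_cons ?sz ?sz' //; apply; rewrite v0 leqW.
Qed.

(** * Parent lists give recursive trees *)

Section Edges.
Variables (n : nat) (s : seq nat).
Hypothesis hs : s \in parent_lists n.
Let e := adj (edges n.+1 s).

Lemma edges_sym : symmetric e.
Proof. by move=> u v; rewrite /e /adj !inE /= orbC. Qed.

(** Parents have smaller labels, so an edge can only be recorded at its larger end. *)
Lemma edges_lt (u v : 'I_n.+1) : (u < v)%N -> e u v = (parent s v == u).
Proof.
move=> uv; rewrite /e /adj inE /= (leq_ltn_trans _ uv) //=.
case: (posnP u) => [->|u0]; first by rewrite orbF.
apply/orb_idr => /eqP pu; have := parent_lt hs (v := u).
by rewrite pu u0 -ltnS ltn_ord /= => /(_ isT); rewrite ltnNge ltnW.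
Qed.

Lemma edges_irr : irreflexive e.
Proof.
move=> u; rewrite /e /adj inE /= orbb; apply/negP => /andP[u0 /eqP pu].
by have := parent_lt hs (v := u); rewrite pu u0 -ltnS ltn_ord ltnn => /(_ isT).
Qed.

Lemma edges_neq (u v : 'I_n.+1) : e u v -> u != v.
Proof. by apply: contraL => /eqP ->; rewrite edges_irr. Qed.

Lemma edges_le (u v : 'I_n.+1) : e u v -> (u <= v)%N -> (u < v)%N /\ parent s v = u.
Proof.
move=> uv; rewrite leq_eqVlt => /orP[/eqP/val_inj uv'|lt_uv].
  by have := edges_neq uv; rewrite uv' eqxx.
by move: uv; rewrite edges_lt // => /eqP.
Qed.

Lemma edges_connected : connected_graph (edges n.+1 s).
Proof.
have h0 v : connect e ord0 v.
  have [m] := ubnP (v : nat); elim: m v => // m IHm v; rewrite ltnS => vm.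
  have [v0|v0] := posnP v.
    by rewrite (_ : v = ord0) ?connect0 //; apply: val_inj.
  have pv : (parent s v < v)%N by rewrite (parent_lt hs) // v0 -ltnS ltn_ord.
  have pn : (parent s v < n.+1)%N := ltn_trans pv (ltn_ord v).
  apply: (connect_trans (IHm (Ordinal pn) (leq_trans pv vm))).
  by apply: connect1; rewrite edges_lt.
move=> u v; apply: connect_trans (h0 v).
by rewrite (sym_connect_sym edges_sym).
Qed.

(* The largest vertex of a cycle would have two distinct smaller neighbours. *)
Lemma edges_acyclic : acyclic_graph (edges n.+1 s).
Proof.
move=> c sc hc.
have [x xc hx] : exists2 x, x \in c & forall y, y \in c -> (y <= x)%N.
  have [x0 x0c] : exists x, x \in c by case: (c) sc => // a ? _; exists a; rewrite mem_head.
  by case: (arg_maxnP (P := fun x => x \in c) val x0c) => x xc hx; exists x.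
have [i r rE] := rot_to xc.
have : ucycle e (x :: r) by rewrite -rE rot_ucycle.
have sr : (1 < size r)%N by rewrite -ltnS -/(size (x :: r)) -rE size_rot.
have hr y : y \in r -> (y <= x)%N.
  by move=> yr; apply: hx; rewrite -(mem_rot i) rE inE yr orbT.
case: r {rE} sr hr => [|y r] // sr hr /andP[/= /andP[xy]].
rewrite rcons_path => /andP[_ zx] /and3P[_ yr _].
have zr : last y r \in r by case: (r) sr => // ? ? _; rewrite /= mem_last.
have [_ yE] := edges_le (etrans (edges_sym y x) xy) (hr y (mem_head _ _)).
have [|_ zE] := edges_le zx; first by apply: hr; rewrite inE zr orbT.
by move: yr; rewrite (_ : y = last y r) ?zr //; apply: val_inj; rewrite /= -yE -zE.
Qed.

(** A path that has just climbed to [x] came from the parent of [x], its only smaller neighbour;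
    going down from [x] would therefore repeat a vertex. *)
Lemma edges_increasing (r : seq 'I_n.+1) :
  path e ord0 r -> uniq (ord0 :: r) -> sorted ltn [seq label v | v <- ord0 :: r].
Proof.
elim/last_ind: r => [|r y IHr] //.
rewrite rcons_path -rcons_cons rcons_uniq => /andP[hr xy] /andP[yr ur].
rewrite map_rcons /= rcons_path; apply/andP; split; first exact: IHr.
rewrite (last_map (@label n.+1)) /label /= ltnS.
have IH := IHr hr ur; move: hr xy yr IH {IHr ur}.
case/lastP: r => [|r x].
  move=> _ /= /edges_neq; rewrite inE => _ y0 _; rewrite lt0n.
  by apply: contra y0 => /eqP y0; apply/eqP/val_inj.
rewrite last_rcons rcons_path => /andP[_ zx] xy yr.
rewrite /= map_rcons rcons_path (last_map (@label n.+1)) => /andP[_ /ltnW lt_zx].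
have [_ zE] := edges_le zx lt_zx.
rewrite ltnNge; apply/negP => yx.
have [_ yE] := edges_le (etrans (edges_sym y x) xy) yx.
move: yr; rewrite (_ : y = last ord0 r); last by apply: val_inj; rewrite /= -yE -zE.
by rewrite -rcons_cons mem_rcons inE mem_last orbT.
Qed.

Lemma edges_recursive : (ord0, edges n.+1 s) \in recursive_trees n.+1.
Proof.
rewrite inE; apply/asboolP; split; last exact: edges_increasing.
split; [split; [exact: edges_sym|exact: edges_irr]| |].
  exact: edges_connected.
exact: edges_acyclic.
Qed.

End Edges.

(** * Every recursive tree comes from a parent list *)

Section FromRecursive.
Variables (n : nat) (T : 'I_n.+1 * {set 'I_n.+1 * 'I_n.+1}).
Hypothesis hT : is_recursive_tree T.
Let e := adj T.2.

Let eC : symmetric e. Proof. by case: hT => -[[]]. Qed.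

Lemma recursive_path v : exists2 r, path e T.1 r & uniq (T.1 :: r) /\ last T.1 r = v.
Proof.
have [[_ /(_ T.1 v)/connectP[r hr ->] _] _] := hT.
by case: (shortenP hr) => r' hr' ur' _; exists r'.
Qed.

Lemma recursive_sorted r : path e T.1 r -> uniq (T.1 :: r) ->
  path (fun u v : 'I_n.+1 => u < v)%N T.1 r.
Proof.
case: hT => _ h hr ur; have := h r hr ur.
by rewrite /= path_map; apply: sub_path => u v.
Qed.

Lemma recursive_path_le r : path e T.1 r -> uniq (T.1 :: r) ->
  forall v, v \in T.1 :: r -> (v <= last T.1 r)%N.
Proof.
move=> hr ur; have := recursive_sorted hr ur.
elim/last_ind: r {hr ur} => [_ v|r x IHr]; first by rewrite inE => /eqP ->.
rewrite rcons_path last_rcons => /andP[/IHr h hx] v.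
rewrite -rcons_cons mem_rcons inE => /orP[/eqP -> //|/h hv].
exact: leq_trans hv (ltnW hx).
Qed.

Lemma recursive_root : T.1 = ord0.
Proof.
have [r hr [ur hl]] := recursive_path ord0.
have := recursive_path_le hr ur (mem_head _ _).
by rewrite hl leqn0 => /eqP h; apply: val_inj.
Qed.

(** The increasing path from the root to [v] enters [v] from a smaller neighbour. *)
Lemma recursive_parent (v : 'I_n.+1) : (0 < v)%N ->
  exists2 u : 'I_n.+1, (u < v)%N & e u v.
Proof.
move=> v0; have [r hr [ur hl]] := recursive_path v.
have := recursive_sorted hr ur; case/lastP: r hr ur hl => [|r x].
  by move=> _ _ /=; rewrite recursive_root => vE; rewrite -vE in v0.
rewrite !rcons_path last_rcons => /andP[_ hx] _ xv /andP[_ lt_x]; rewrite -xv.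
by exists (last T.1 r).
Qed.

(** If [x < y] were two smaller neighbours of [v], the path from the root to [x], continued by [v]
    and [y], would have no repetition and yet descend at its last step. *)
Lemma recursive_parent_uniq (u u' v : 'I_n.+1) :
  (u < v)%N -> (u' < v)%N -> e u v -> e u' v -> u = u'.
Proof.
have aux (x y : 'I_n.+1) : (x < y)%N -> (y < v)%N -> e x v -> e y v -> False.
  move=> xy yv exv eyv; have [r hr [ur hl]] := recursive_path x.
  have le_x := recursive_path_le hr ur; rewrite hl in le_x.
  have vr : v \notin T.1 :: r.
    by apply/negP => /le_x; rewrite leqNgt (ltn_trans xy yv).
  have yr : y \notin T.1 :: r by apply/negP => /le_x; rewrite leqNgt xy.
  have vy : v != y by apply/eqP => vy; rewrite vy ltnn in yv.
  have /recursive_sorted : path e T.1 (rcons (rcons r v) y).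
    by rewrite !rcons_path !last_rcons hl hr exv eC eyv.
  have -> : T.1 :: rcons (rcons r v) y = rcons (rcons (T.1 :: r) v) y by [].
  rewrite !rcons_uniq mem_rcons in_cons negb_or eq_sym vy yr vr ur => /(_ isT).
  by rewrite !rcons_path !last_rcons => /andP[_]; rewrite ltnNge ltnW.
move=> uv u'v eu eu'; have [h|h|/val_inj-> //] := ltngtP u u'.
  by case: (aux u u' h u'v eu eu').
by case: (aux u' u h uv eu' eu).
Qed.

Lemma recursive_edges : exists2 s, s \in parent_lists n & T = (ord0, edges n.+1 s).
Proof.
pose p (v : nat) : nat :=
  odflt ord0 [pick u : 'I_n.+1 | (u < v)%N && e u (inord v)].
have hp (v : 'I_n.+1) : (0 < v)%N -> exists2 u : 'I_n.+1, p v = u & (u < v)%N /\ e u v.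
  move=> v0; rewrite /p; case: pickP => [u /andP[uv]|h].
    by rewrite inord_val => eu; exists u.
  have [u uv eu] := recursive_parent v0.
  by have := h u; rewrite uv inord_val eu.
have [v /andP[v0 vn]|s hs ps] := @parent_list_exists n p.
  by have [u /= -> []] := hp (Ordinal (vn : v < n.+1)%N) v0.
exists s => //; rewrite [LHS]surjective_pairing recursive_root; congr (_, _).
have eE (u v : 'I_n.+1) : (u < v)%N -> e u v = (parent s v == u).
  move=> uv; have v0 := leq_ltn_trans (leq0n _) uv.
  rewrite ps; last by rewrite v0 -ltnS ltn_ord.
  have [w -> [wv ew]] := hp v v0.
  apply/idP/eqP => [eu|/val_inj <- //].
  by rewrite (recursive_parent_uniq wv uv ew eu).
apply/setP => -[u v]; rewrite -[LHS]/(e u v) -[RHS]/(adj (edges n.+1 s) u v).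
have [[[_ irr] _ _] _] := hT.
case: (ltngtP u v) => [uv|vu|/val_inj ->].
- by rewrite eE // (edges_lt hs).
- by rewrite eC (edges_sym s) eE // (edges_lt hs).
- by rewrite (irr v : e v v = false) (edges_irr hs).
Qed.

End FromRecursive.

Lemma edges_inj n s s' : s \in parent_lists n -> s' \in parent_lists n ->
  edges n.+1 s = edges n.+1 s' -> s = s'.
Proof.
move=> hs hs' ss'; apply: (parent_inj hs hs') => v /andP[v0 vn].
have pv := parent_lt hs (v := v); rewrite v0 vn in pv.
have pn : (parent s v < n.+1)%N by apply: ltn_trans (pv isT) _.
have := edges_lt hs (u := Ordinal pn) (v := Ordinal (vn : v < n.+1)%N) (pv isT).
by rewrite ss' (edges_lt hs') ?pv // eqxx => /eqP.
Qed.

Lemma sum_recursive_trees (R : nmodType) n (F : 'I_n.+1 * {set 'I_n.+1 * 'I_n.+1} -> R) :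
  \sum_(T in recursive_trees n.+1) F T =
  \sum_(s <- parent_lists n) F (ord0, edges n.+1 s).
Proof.
rewrite -big_enum /= -(big_map (fun s => (ord0, edges n.+1 s)) xpredT F).
apply: perm_big; apply: uniq_perm; first exact: enum_uniq.
  rewrite map_inj_in_uniq ?parent_lists_uniq // => s s' hs hs' [].
  exact: edges_inj.
move=> T; rewrite mem_enum; apply/idP/mapP => [|[s hs ->]].
  by rewrite inE => /asboolP/recursive_edges.
exact: edges_recursive.
Qed.

(** * The characteristic polynomial near zero *)

Section Elimination.
Variable R : realType.

(** Eliminating a leaf from [x - A] alters only the diagonal, so an arbitrary diagonal [d] makes
    this class of matrices stable under elimination. *)
Definition weighted_mx n (d : nat -> R) (s : seq nat) : 'M[R]_n :=
  \matrix_(i, j) (if i == j then d i else - (adj (edges n s) i j)%:R).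

Lemma horner_char_poly n (s : seq nat) (x : R) :
  irreflexive (adj (edges n s)) ->
  (char_poly (adjacency_matrix R (edges n s))).[x] = \det (weighted_mx n (fun=> x) s).
Proof.
move=> irr; rewrite -horner_evalE -det_map_mx; congr (\det _).
apply/matrixP => i j; rewrite !mxE /= horner_evalE hornerD hornerN hornerC hornerMn hornerX.
case: eqP => [->|_]; first by rewrite irr subr0.
by rewrite sub0r.
Qed.

(** The last vertex is a leaf adjacent to [u] only; elimination with the pivot [d n.+1] affects the
    remaining matrix only at the diagonal entry of [u]. *)
Lemma det_weighted_mx n (d : nat -> R) u s : s \in parent_lists n -> (u <= n)%N ->
  d n.+1 != 0 ->
  \det (weighted_mx n.+2 d (u :: s)) =
  d n.+1 * \det (weighted_mx n.+1
                   (fun v => if v == u then d v - (d n.+1)^-1 else d v) s).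
Proof.
move=> hs un d0; have hus : u :: s \in parent_lists n.+1 by rewrite parent_listsP un.
have sz := size_parent_lists hs.
have un2 : (u < n.+2)%N by rewrite ltnS leqW.
set A := weighted_mx _ _ _; pose w : 'I_n.+2 := Ordinal un2.
(* Right multiplication by [L] adds the last column, divided by the pivot, to column [w], which
   clears the last row off the diagonal. *)
pose L : 'M[R]_n.+2 := 1 + (d n.+1)^-1 *: delta_mx ord_max w.
have detL : \det L = 1.
  rewrite det_trig; last first.
    apply/is_trig_mxP => i j ij; rewrite !mxE.
    rewrite (_ : (i == j) = false) ?add0r; last by apply/eqP => ij'; rewrite ij' ltnn in ij.
    case: eqP => [iE|]; rewrite ?mulr0 //.
    by move: ij; rewrite iE ltnNge -ltnS ltn_ord.
  apply: big1 => i _; rewrite !mxE eqxx; case: eqP => [->|_]; rewrite ?mulr0 ?addr0 //=.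
  rewrite (_ : (ord_max == w) = false) ?mulr0 ?addr0 //.
  by apply/eqP => /(congr1 val) /= uE; rewrite -uE ltnn in un.
have LE i j : (A *m L) i j = A i j + (d n.+1)^-1 * (A i ord_max * (j == w)%:R).
  rewrite mulmxDr mulmx1 -scalemxAr !mxE; congr (_ + _ * _).
  rewrite (bigD1 ord_max) //= big1 ?addr0 ?mxE ?eqxx // => k kn.
  by rewrite !mxE (negPf kn) mulr0.
have adjmax (i : 'I_n.+2) : i != ord_max -> adj (edges n.+2 (u :: s)) i ord_max = (i == w).
  move=> im; rewrite (edges_lt hus); last first.
    by rewrite ltn_neqAle -ltnS ltn_ord andbT.
  by rewrite (parent_last _ sz) eq_sym.
have -> : \det A = \det (A *m L) by rewrite det_mulmx detL mulr1.
rewrite (expand_det_row _ ord_max) (bigD1 ord_max) //= big1 ?addr0 => [|j jm].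
  rewrite LE mxE eqxx /=.
  rewrite (_ : (ord_max == w) = false) ?mulr0 ?addr0; last first.
    by apply/eqP => /(congr1 val) /= uE; rewrite -uE ltnn in un.
  congr (_ * _); rewrite /cofactor -signr_odd addnn odd_double mul1r.
  congr (\det _); apply/matrixP => i j; rewrite 2![LHS]mxE LE !mxE.
  set i' := lift ord_max i; set j' := lift ord_max j.
  have lm (k : 'I_n.+1) : (lift ord_max k == ord_max) = false.
    by rewrite eq_sym (negPf (neq_lift _ _)).
  have lw (k : 'I_n.+1) : (lift ord_max k == w) = (k == u :> nat).
    by rewrite -val_eqE /= /bump leqNgt ltn_ord.
  rewrite lm adjmax ?lm // !lw (inj_eq lift_inj) /i' /= /bump leqNgt ltn_ord add0n.
  have -> : adj (edges n.+2 (u :: s)) (lift ord_max i) (lift ord_max j) =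
            adj (edges n.+1 s) i j.
    rewrite /adj !inE /= /bump !(leqNgt n.+1) !ltn_ord !add0n.
    by rewrite !parent_cons // sz -ltnS ltn_ord.
  case: (i =P j) => [->|ij]; first by case: eqP; rewrite /= ?mulr1 ?mulr0 ?addr0 ?mulrN1.
  case: (i =P u :> nat) => [iu|_]; last by rewrite oppr0 mul0r mulr0 addr0.
  case: eqP => [ju|_]; last by rewrite !mulr0 addr0.
  by case: ij; apply: val_inj; rewrite /= iu ju.
rewrite LE !mxE eqxx eq_sym (negPf jm) (edges_sym (u :: s)) adjmax //=.
by case: eqP => _; rewrite ?mulr1 ?mulVf ?addNr ?mulr0 ?oppr0 ?addr0 ?mul0r.
Qed.

(* Pivots of Gaussian elimination from the leaves to the root, at [x -> 0+]:
   those of free vertices are equivalent to [a x], the others to [- a / x]. *)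
Definition pivot_type (free : bool) (f : R -> R) : Prop :=
  exists2 a : R, 0 < a &
  if free then f x / x @[x --> 0^'+] --> a else x * f x @[x --> 0^'+] --> - a.

Lemma near_right_neq0 : \forall x \near (0 : R)^'+, x != 0.
Proof. by have := nbhs_right_gt (0 : R); apply: filterS => x; exact: lt0r_neq0. Qed.

Lemma cvg_right_id : x @[x --> (0 : R)^'+] --> (0 : R).
Proof. exact: cvg_at_right_filter. Qed.

(** A free child contributes [- 1 / (b x)], which dominates a free parent's [a x]; a matched child
    contributes [x / b]. Whenever the two terms have the same order they have the same sign, so no
    cancellation occurs. *)
Lemma pivot_type_sub bf bg f g : pivot_type bf f -> pivot_type bg g ->
  pivot_type (bf && ~~ bg) (fun x => f x - (g x)^-1).
Proof.
have sq0 : x * x @[x --> (0 : R)^'+] --> (0 : R).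
  by rewrite -[X in _ --> X](mulr0 0); apply: cvgM; exact: cvg_right_id.
case: bf => -[a a0 fa]; case: bg => -[b b0 gb] /=.
- exists b^-1; first by rewrite invr_gt0.
  have h : x * x * (f x / x) - (g x / x)^-1 @[x --> 0^'+] --> - b^-1.
    rewrite -[X in _ --> X]add0r -[X in _ --> X - _](mul0r a).
    by apply: cvgB; [exact: cvgM|apply: cvgV => //; exact: lt0r_neq0].
  apply: cvg_trans h; apply: near_eq_cvg; near=> x.
  have x0 : x != 0 by near: x; exact: near_right_neq0.
  by rewrite invf_div mulrBr -mulrA [x * (f x / x)]mulrC divfK.
- exists (a + b^-1); first by rewrite addr_gt0 ?invr_gt0.
  have h : f x / x - (x * g x)^-1 @[x --> 0^'+] --> a + b^-1.
    rewrite -[b^-1]opprK -invrN.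
    by apply: cvgB => //; apply: cvgV => //; rewrite oppr_eq0 lt0r_neq0.
  apply: cvg_trans h; apply: near_eq_cvg; near=> x.
  by rewrite invfM mulrBl [x^-1 * _]mulrC.
- exists (a + b^-1); first by rewrite addr_gt0 ?invr_gt0.
  have h : x * f x - (g x / x)^-1 @[x --> 0^'+] --> - (a + b^-1).
    rewrite opprD; apply: cvgB => //; apply: cvgV => //; exact: lt0r_neq0.
  apply: cvg_trans h; apply: near_eq_cvg; near=> x.
  by rewrite invf_div mulrBr.
- exists a => //.
  have h : x * f x - x * x * (x * g x)^-1 @[x --> 0^'+] --> - a.
    rewrite -[X in _ --> X]subr0 -[X in _ --> _ - X](mul0r (- b)^-1).
    apply: cvgB => //; apply: cvgM => //; apply: cvgV => //.
    by rewrite oppr_eq0 lt0r_neq0.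
  apply: cvg_trans h; apply: near_eq_cvg; near=> x.
  have x0 : x != 0 by near: x; exact: near_right_neq0.
  by rewrite invfM mulrBr -[x * x * _]mulrA mulVKf.
Unshelve. all: by end_near. Qed.

Lemma pivot_type_neq0 b f : pivot_type b f -> \forall x \near 0^'+, f x != 0.
Proof.
move=> -[a a0]; case: b => fa.
  have h := cvgr_neq0 _ fa (lt0r_neq0 a0).
  near=> x; have : f x / x != 0 by near: x; exact: h.
  by rewrite mulf_eq0 negb_or => /andP[].
have na : - a != 0 by rewrite oppr_eq0 lt0r_neq0.
have h := cvgr_neq0 _ fa na.
near=> x; have : x * f x != 0 by near: x; exact: h.
by rewrite mulf_eq0 negb_or => /andP[].
Unshelve. all: by end_near. Qed.

(** The last vertex is eliminated first: its pivot supplies a factor of order [x] or [1 / x], and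
    [settle] records the new pivot type of [u], in step with [surplus_insert]. Arbitrary pivot types
    are allowed for the sake of this induction. *)
Lemma cvg_det_weighted_mx n s (d : R -> nat -> R) tau : s \in parent_lists n ->
  (forall v, (v <= n)%N -> pivot_type (tau v) (d^~ v)) ->
  exists2 c : R, c != 0 &
    \det (weighted_mx n.+1 (d x) s) * x ^ (- surplus tau (tree_of s))
      @[x --> 0^'+] --> c.
Proof.
elim: n s d tau => [|n IHn] [|u s] d tau; rewrite ?parent_lists0 //.
  move=> _ /(_ 0%N (leqnn _)) [a a0]; rewrite /pivot_type /=.
  case: (tau 0%N) => h.
    exists a; first exact: lt0r_neq0.
    apply: cvg_trans h; apply: near_eq_cvg; near=> x.
    by rewrite det_mx11 mxE eqxx.
  exists (- a); first by rewrite oppr_eq0 lt0r_neq0.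
  apply: cvg_trans h; apply: near_eq_cvg; near=> x.
  by rewrite det_mx11 mxE eqxx opprK expr1z mulrC.
rewrite parent_listsP => /andP[un hs] hd; have sz := size_parent_lists hs.
pose d' x v := if v == u then d x v - (d x n.+1)^-1 else d x v.
have hlast := hd n.+1 (leqnn _).
have [|c c0 hc] := IHn s d' (settle tau u n.+1) hs.
  move=> v vn; rewrite /settle /d'; have [->|vu] := eqVneq v u.
    have -> : (if tau n.+1 then fun v => tau v && (v != u) else tau) u
        = tau u && ~~ tau n.+1.
      by case: (tau n.+1); rewrite ?eqxx ?andbF ?andbT.
    by apply: pivot_type_sub => //; apply: hd; exact: leqW.
  have -> : (if tau n.+1 then fun v => tau v && (v != u) else tau) v = tau v.
    by case: (tau n.+1); rewrite ?vu ?andbT.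
  by apply: hd; exact: leqW.
have hp := perm_vertices_tree_of hs; have hu := perm_uniq hp; rewrite iota_uniq in hu.
have us : u \in vertices (tree_of s) by rewrite (perm_mem hp) mem_iota add0n ltnS.
rewrite /= sz surplus_insert //.
have [l l0 hl] : exists2 l : R, l != 0 &
    d x n.+1 * x ^ (- (if tau n.+1 then 1 else -1)) @[x --> 0^'+] --> l.
  case: hlast => a a0; case: (tau n.+1) => ha.
    by exists a => //; exact: lt0r_neq0.
  exists (- a); first by rewrite oppr_eq0 lt0r_neq0.
  by apply: cvg_trans ha; apply: near_eq_cvg; near=> x; rewrite opprK expr1z mulrC.
exists (l * c); first by rewrite mulf_neq0.
apply: cvg_trans (cvgM hl hc); apply: near_eq_cvg; near=> x.
have x0 : x != 0 by near: x; exact: near_right_neq0.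
have dx0 : d x n.+1 != 0 by near: x; exact: pivot_type_neq0 hlast.
rewrite det_weighted_mx // opprD expfzDr //=; ring.
Unshelve. all: by end_near. Qed.

(** With [p = q X ^ m] and [q.[0]] nonzero, the quotient behaves like [q.[0] * x ^ (m - k)], whose
    limit is finite and nonzero only for [m = k]. *)
Lemma mup0_cvg (p : {poly R}) (k : int) (c : R) : c != 0 ->
  p.[x] * x ^ (- k) @[x --> 0^'+] --> c -> (mup 0 p)%:Z = k.
Proof.
move=> c0 hc.
have p0 : p != 0.
  apply: contra_neq c0 => p0; move: hc; rewrite p0 => hc.
  apply: (cvg_unique _ hc) => //=; under eq_fun do rewrite horner0 mul0r.
  exact: cvg_cst.
have [m [q]] := multiplicity_XsubC p 0; rewrite p0 /= subr0 => q0 pE.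
have -> : mup 0 p = m.
  rewrite pE mupMr // -['X]subr0 mup_XsubCX eqxx //.
have {}q0 : q.[0] != 0 by rewrite -rootE.
have hq : q.[x] @[x --> 0^'+] --> q.[0].
  by apply: cvg_at_right_filter; exact: continuous_horner.
have h : x ^ (m%:Z - k) @[x --> 0^'+] --> q.[0]^-1 * c.
  apply: cvg_trans (cvgM (cvgV q0 hq) hc); apply: near_eq_cvg; near=> x.
  have x0 : x != 0 by near: x; exact: near_right_neq0.
  have qx0 : q.[x] != 0 by near: x; exact: cvgr_neq0 hq q0.
  rewrite -[LHS]/(q.[x]^-1 * (p.[x] * x ^ (- k))) pE hornerM hornerXn.
  by rewrite expfzDr // -mulrA mulKf.
have l0 : q.[0]^-1 * c != 0 by rewrite mulf_neq0 ?invr_eq0.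
have pow0 j : x ^+ j.+1 @[x --> (0 : R)^'+] --> (0 : R).
  rewrite -[X in _ --> X](expr0n R j.+1) //.
  by apply: cvg_at_right_filter; exact: exprn_continuous.
apply/eqP; rewrite -subr_eq0; case: (m%:Z - k) h => [[|j]|j] // h; exfalso.
  by move/eqP: l0; apply; exact: (cvg_unique (@norm_hausdorff _ _) h (pow0 j)).
(* Here [m < k]; multiplying by the inverse power of [x], which tends to 0, would give [1 = 0] in
   the limit. *)
have h1 := cvgM (pow0 j) h; rewrite mul0r in h1.
have h2 : (1 : R) @[x --> (0 : R)^'+] --> (0 : R).
  apply: cvg_trans (h1 _); apply: near_eq_cvg; near=> x.
  have x0 : x != 0 by near: x; exact: near_right_neq0.
  by rewrite /= divff // expf_neq0.
have : (0 : R) = 1 by exact: (cvg_unique (@norm_hausdorff _ _) h2 (cvg_cst _)).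
by move/eqP; rewrite eq_sym oner_eq0.
Unshelve. all: by end_near. Qed.

Lemma N0_tree_of n s : s \in parent_lists n ->
  (N0 R (ord0, edges n.+1 s))%:Z = surplus xpredT (tree_of s).
Proof.
move=> hs.
have hd v : (v <= n)%N -> pivot_type true (fun x : R => x).
  move=> _; exists 1 => //.
  have h : (1 : R) @[x --> (0 : R)^'+] --> (1 : R) by exact: cvg_cst.
  apply: cvg_trans h; apply: near_eq_cvg; near=> x.
  by rewrite divff //; near: x; exact: near_right_neq0.
have [c c0 hc] := cvg_det_weighted_mx (tau := xpredT) hs hd.
apply: (mup0_cvg c0); apply: cvg_trans hc; apply: near_eq_cvg; near=> x.
by rewrite horner_char_poly //; exact: edges_irr.
Unshelve. all: by end_near. Qed.

Lemma mean_N0E n : mean_N0 R n.+1 = mean_surplus R n.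
Proof.
rewrite /mean_N0 -sum1_card natr_sum !sum_recursive_trees.
rewrite (eq_big_seq (fun s => (surplus xpredT (shape (tree_of s)))%:~R)); last first.
  by move=> s hs; rewrite surplus_shape -(N0_tree_of hs).
rewrite (sum_parent_lists (fun t => (surplus xpredT t)%:~R)).
rewrite (sum_parent_lists (fun=> 1 : R)).
(* The mean of the constant 1 identifies the number of recursive trees with [n!]. *)
have := avg_cst n (1 : R); rewrite /mean_surplus /avg.
have nf : n`!%:R != 0 :> R by rewrite pnatr_eq0 -lt0n fact_gt0.
by move/(canRL (mulfVK nf)); rewrite mul1r => ->.
Qed.

End Elimination.

(** * Asymptotics *)

Lemma sum_triangle (V : nmodType) (F : nat -> nat -> V) n :
  \sum_(i < n) \sum_(j < i.+1) F j (i - j)%N =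
  \sum_(j < n) \sum_(k < n - j) F j k.
Proof.
elim: n => [|n IHn]; first by rewrite !big_ord0.
rewrite big_ord_recr /= IHn [RHS](eq_bigr (fun j : 'I_n.+1 =>
  \sum_(k < n - j) F j k + F j (n - j)%N)) => [|j _]; last first.
  by rewrite subSn ?big_ord_recr // -ltnS.
by rewrite big_split /= [X in _ = X + _]big_ord_recr /= subnn big_ord0 addr0.
Qed.

(** * Partial sums of Cauchy products with nonnegative terms *)

Section CauchyProduct.
Variables (R : numDomainType) (a b : nat -> R).
Hypotheses (a0 : forall i, 0 <= a i) (b0 : forall i, 0 <= b i).

Let prod N := \sum_(i < N) \sum_(j < i.+1) a j * b (i - j)%N.
Let le_sum (c : nat -> R) m n : (forall i, 0 <= c i) -> (m <= n)%N ->
  \sum_(i < m) c i <= \sum_(i < n) c i.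
Proof.
by move=> c0 mn; rewrite -(subnKC mn) big_split_ord /= lerDl sumr_ge0.
Qed.

(** The triangle [j + k < N] of indices lies in the square of side [N]. *)
Lemma cauchy_prod_le N : prod N <= (\sum_(i < N) a i) * (\sum_(i < N) b i).
Proof.
rewrite /prod (sum_triangle (fun j k => a j * b k)) mulr_suml.
apply: ler_sum => i _; rewrite -mulr_sumr ler_wpM2l // le_sum //.
exact: leq_subr.
Qed.

(** The square of side [N] lies in the triangle [j + k < 2 N]. *)
Lemma cauchy_prod_ge N : (\sum_(i < N) a i) * (\sum_(i < N) b i) <= prod (N + N).
Proof.
rewrite /prod (sum_triangle (fun j k => a j * b k)).
pose G (i : nat) := \sum_(k < N + N - i) a i * b k.
rewrite -[X in _ <= X]/(\sum_(i < N + N) G i).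
apply: (@le_trans _ _ (\sum_(i < N) G i)); last first.
  by apply: le_sum; rewrite ?leq_addr // => i; rewrite sumr_ge0 // => k _; rewrite mulr_ge0.
rewrite mulr_suml; apply: ler_sum => i _; rewrite /G -mulr_sumr ler_wpM2l //.
by apply: le_sum => //; have := ltn_ord i; lia.
Qed.

End CauchyProduct.

(** * Generating function and decay of the root probabilities *)

Section RootProbability.
Variable R : realType.
Local Notation q := (root_prob R).

(* The coefficients of [1 - ln (1 - x)]. *)
Definition log_coef (k : nat) : R := if k is 0 then 1 else k%:R^-1.

Lemma log_coef_ge0 k : 0 <= log_coef k.
Proof. by case: k => [|k] //=; rewrite invr_ge0. Qed.

(* In terms of the generating function [Q] of [q], [root_prob_split] is
   [Q' = Q (1 / (1 - x) - Q)], whose solution is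
   [Q = 1 / ((1 - x) (1 - ln (1 - x)))]. *)
Lemma root_prob_conv m : \sum_(i < m.+1) q i * log_coef (m - i) = 1.
Proof.
have [n] := ubnP m; elim: n m => // n IHn [|m] mn.
  by rewrite big_ord_recr big_ord0 /= root_prob0 add0r mulr1.
apply: (mulfI (_ : m.+1%:R != 0)); first by rewrite pnatr_eq0.
rewrite big_ord_recr /= subnn mulr1 mulrDr root_prob_split mulr1 mulr_sumr.
(* Splitting [m + 1 = (m + 1 - i) + i] is the product rule for [Q (1 - ln (1 - x))], read on
   coefficients. *)
have E (i : 'I_m.+1) : m.+1%:R * (q i * log_coef (m.+1 - i)) =
    q i + i%:R * q i * log_coef (m.+1 - i).
  have im : (i <= m)%N by rewrite -ltnS.
  rewrite subSn //=.
  have -> : m.+1%:R = (m - i).+1%:R + i%:R :> R by rewrite -natrD addSn subnK.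
  have : (m - i).+1%:R != 0 :> R by rewrite pnatr_eq0.
  by move: (m - i).+1%:R => d d0; field.
rewrite (eq_bigr _ (fun i _ => E i)) big_split /=.
(* Each [i * q i] is expanded by [root_prob_split] and the sums are exchanged; the inner sum is the
   induction hypothesis at [m - j] without its last term, that is [1 - q (m - j)]. *)
have -> : \sum_(i < m.+1) i%:R * q i * log_coef (m.+1 - i) =
    \sum_(j < m.+1) (1 - q j) * (1 - q (m - j)).
  rewrite big_ord_recl !mul0r add0r.
  pose F j k := q k * (1 - q j) * log_coef (m - (j + k)).
  rewrite (eq_bigr (fun i : 'I_m => \sum_(j < i.+1) F j (i - j)%N)) => [|i _].
    rewrite (sum_triangle F) big_ord_recr /= subnn root_prob0 subrr mulr0 addr0.
    apply: eq_bigr => j _; rewrite -[X in _ * (X - _)](IHn (m - j)%N); last first.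
      by rewrite (leq_ltn_trans (leq_subr _ _)).
    rewrite big_ord_recr /= subnn mulr1 addrK mulr_sumr.
    by apply: eq_bigr => k _; rewrite /F subnDA; ring.
  rewrite /= /bump /= add1n subSS root_prob_split mulr_suml.
  by apply: eq_bigr => j _; rewrite /F subnKC // -ltnS.
rewrite -!big_split /= (eq_bigr (fun=> 1)) => [|i _]; last by ring.
by rewrite sumr_const card_ord.
Qed.

Lemma root_prob_pow_conv (u : R) m :
  \sum_(j < m.+1) (q j * u ^+ j) * (log_coef (m - j) * u ^+ (m - j)) = u ^+ m.
Proof.
rewrite -[RHS]mul1r -(root_prob_conv m) mulr_suml; apply: eq_bigr => j _.
have jm : (j <= m)%N by rewrite -ltnS.
by rewrite -[in u ^+ m](subnKC jm) exprD; ring.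
Qed.

Lemma ln_le_sum_log_coef N : ln N%:R <= \sum_(k < N) log_coef k.
Proof.
elim: N => [|[|N] IHN]; first by rewrite big_ord0 ln0.
  by rewrite big_ord_recr big_ord0 /= add0r ln1.
rewrite big_ord_recr /=; apply: le_trans (lerD IHN (lexx _)).
have N0 : 0 < N.+1%:R :> R by rewrite ltr0n.
have -> : N.+2%:R = N.+1%:R * (1 + N.+1%:R^-1) :> R.
  by rewrite mulrDr mulr1 divff ?lt0r_neq0 // natr1.
rewrite lnM ?posrE ?addr_gt0 ?invr_gt0 // lerD2l le_ln1Dx //.
by apply: lt_trans (_ : 0 < _); rewrite ?invr_gt0 // ltrN10.
Qed.

(** The recurrence gives [N * q N <= sum_(j < N) q j]. Times the partial sum of [log_coef], which is
    at least [ln N], the right side is at most the sum of [2 N] convolutions equal to 1. *)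
Lemma root_prob_ln N : ln N%:R * q N <= 2.
Proof.
case: N => [|N]; first by rewrite ln0 // mul0r.
have N0 : 0 < N.+1%:R :> R by rewrite ltr0n.
rewrite -(ler_pM2r N0) -mulrA [q _ * _]mulrC root_prob_split.
have h : \sum_(j < N.+1) q (N - j) * (1 - q j) <= \sum_(j < N.+1) q j.
  rewrite [leRHS](reindex_inj rev_ord_inj) /=; apply: ler_sum => j _.
  by rewrite subSS ler_piMr ?root_prob_ge0 // lerBlDr lerDl root_prob_ge0.
apply: le_trans (ler_wpM2l _ h) _; first by rewrite ln_ge0 // ler1n.
apply: le_trans (ler_wpM2r _ (ln_le_sum_log_coef N.+1)) _.
  by rewrite sumr_ge0 // => j _; exact: root_prob_ge0.
rewrite mulrC.
have := cauchy_prod_ge (root_prob_ge0 R) log_coef_ge0 N.+1.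
move/le_trans; apply; rewrite (eq_bigr (fun=> 1)) => [|i _].
  by rewrite sumr_const card_ord addnn -mul2n natrM.
exact: root_prob_conv.
Qed.

Lemma is_derive_log_poly N (x : R) :
  is_derive x 1 (fun t => \sum_(k < N.+1) log_coef k * t ^+ k) (\sum_(k < N) x ^+ k).
Proof.
elim: N => [|N IHN].
  rewrite big_ord0 (_ : (fun t => _) = cst 1); first exact: is_derive_cst.
  by apply/funext => t; rewrite big_ord_recr big_ord0 /= add0r mulr1.
rewrite (_ : (fun t => _) = (fun t => \sum_(k < N.+1) log_coef k * t ^+ k)
    \+ (fun t => log_coef N.+1 * t ^+ N.+1)); last first.
  by apply/funext => t; rewrite big_ord_recr.
rewrite big_ord_recr /=; apply: is_deriveD => //.
rewrite (_ : (fun t => _) = N.+1%:R^-1 *: (@id R ^+ N.+1)); last first.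
  by apply/funext => t; rewrite /GRing.scale /= exprfctE.
have /is_derive_eq := is_deriveZ N.+1%:R^-1 (is_deriveX N.+1 (is_derive_id x 1)).
apply; rewrite /=.
by rewrite /GRing.scale /= mulr1 mulrA mulVf ?mul1r // pnatr_eq0.
Qed.

Lemma sum_geometric (u : R) N : u != 1 ->
  \sum_(i < N) u ^+ i = (1 - u ^+ N) / (1 - u).
Proof.
move=> u1; have u10 : 1 - u != 0 by rewrite subr_eq0 eq_sym.
apply: (mulfI u10); rewrite mulrCA divff // mulr1.
by rewrite -opprB mulNr -subrX1 opprB.
Qed.

(** The remainder vanishes at 0 and has derivative [t ^ N / (1 - t)]; the mean value theorem
    applies. *)
Lemma log_poly_bound (u : R) N : 0 <= u < 1 ->
  0 <= 1 - ln (1 - u) - \sum_(k < N.+1) log_coef k * u ^+ k <= u ^+ N / (1 - u).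
Proof.
move=> /andP[u0 u1].
pose g (t : R) : R := 1 - ln (1 - t) - \sum_(k < N.+1) log_coef k * t ^+ k.
pose dg (t : R) := (1 - t)^-1 - \sum_(k < N) t ^+ k.
have hd (t : R) : t < 1 -> is_derive t 1 g (dg t).
  move=> t1.
  have h1 : is_derive t 1 (cst 1 - id : R -> R) (0 - 1) by apply: is_deriveB.
  have h2 : is_derive ((cst 1 - id : R -> R) t) 1 (@ln R) (1 - t)^-1.
    by apply: is_derive1_ln; rewrite /= subr_gt0.
  have h3 := is_deriveB (is_deriveB (is_derive_cst (1 : R) t 1) (is_derive1_comp h2 h1))
    (is_derive_log_poly N t).
  by apply: (is_derive_eq h3); rewrite /dg !sub0r mulrN mulr1 opprK.
have hc : {within `[0, u], continuous g}.
  apply: derivable_within_continuous => t; rewrite in_itv /= => /andP[_ tu].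
  by have [] := hd t (le_lt_trans tu u1).
have hd' (t : R) : t \in `]0, u[%R -> is_derive t 1 g (dg t).
  by rewrite in_itv /= => /andP[_ tu]; apply: hd; exact: lt_trans tu u1.
have [c] := MVT_segment u0 hd' hc.
rewrite in_itv /= => /andP[c0 cu].
have -> : g 0 = 0.
  rewrite /g subr0 ln1 subr0 big_ord_recl /= expr0 mulr1 big1 ?addr0 ?subrr //.
  by move=> i _; rewrite expr0n mulr0.
rewrite subr0 subr0 -/(g u) => ->.
have c1 := le_lt_trans cu u1.
have -> : dg c = c ^+ N / (1 - c).
  rewrite /dg sum_geometric ?lt_eqF // -[X in X - _]mul1r -mulrBl; congr (_ / _); ring.
have cN0 : 0 <= c ^+ N / (1 - c) by rewrite divr_ge0 ?exprn_ge0 // subr_ge0 ltW.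
rewrite mulr_ge0 //=; apply: (@le_trans _ _ (c ^+ N / (1 - c))).
  by rewrite ler_piMr // ltW.
apply: ler_pM; first exact: exprn_ge0.
- by rewrite invr_ge0 subr_ge0 ltW.
- by rewrite lerXn2r.
- by rewrite lef_pV2 ?posrE ?subr_gt0 // lerD2l lerN2.
Qed.

(** The product of the partial sums [A N] and [B N] is squeezed between [(1 - u ^ N) / (1 - u)] and
    [1 / (1 - u)]; dividing by [B N], whose limit is [1 - ln (1 - u)], isolates [A N]. *)
Lemma cvg_root_prob_series (u : R) : 0 <= u < 1 ->
  \sum_(k < N) q k * u ^+ k * (1 - u) @[N --> \oo] --> 1 / (1 - ln (1 - u)).
Proof.
move=> /andP[u0 u1].
have u10 : 0 < 1 - u by rewrite subr_gt0.
have pow0 : u ^+ N @[N --> \oo] --> (0 : R).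
  have := @cvg_geometric R 1 u; rewrite ger0_norm // => /(_ u1).
  by apply: cvg_trans; apply: near_eq_cvg; near=> N; rewrite /geometric /= mul1r.
have ln1 : 1 - ln (1 - u) != 0.
  by rewrite lt0r_neq0 // subr_gt0 (le_lt_trans (ln_le0 _)) ?ltr01 // lerBlDr lerDl.
pose B N := \sum_(k < N) log_coef k * u ^+ k.
have cB : B N @[N --> \oo] --> 1 - ln (1 - u).
  apply/cvgrPdist_le => e e0.
  have : u ^+ N / (1 - u) @[N --> \oo] --> (0 : R).
    by rewrite -[X in _ --> X](mul0r (1 - u)^-1); apply: cvgM => //; exact: cvg_cst.
  move/cvgrPdist_le => /(_ e e0)[M _ hM].
  exists M.+1 => // -[|N] //= MN; have := hM N MN; rewrite sub0r normrN.
  have /andP[h0 hle] := log_poly_bound N (introT andP (conj u0 u1)).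
  rewrite (ger0_norm h0) => h; apply: le_trans hle (le_trans (ler_norm _) h).
pose A N := \sum_(k < N) q k * u ^+ k.
have cAB : A N * B N @[N --> \oo] --> (1 - u)^-1.
  have A0 k : 0 <= q k * u ^+ k by rewrite mulr_ge0 ?root_prob_ge0 ?exprn_ge0.
  have B0 k : 0 <= log_coef k * u ^+ k by rewrite mulr_ge0 ?log_coef_ge0 ?exprn_ge0.
  apply: (@squeeze_cvgr _ _ _ _ (fun N => (1 - u ^+ N) / (1 - u)) (fun=> (1 - u)^-1)).
  - near=> N; apply/andP; split.
      have := cauchy_prod_le A0 B0 N; rewrite (eq_bigr (fun i : 'I_N => u ^+ i)).
        by rewrite sum_geometric ?lt_eqF.
      by move=> i _; exact: root_prob_pow_conv.
    have := cauchy_prod_ge A0 B0 N; rewrite (eq_bigr (fun i : 'I_(N + N) => u ^+ i)).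
      rewrite sum_geometric ?lt_eqF // => /le_trans; apply.
      apply: ler_piMl; first by rewrite invr_ge0 ltW.
      by rewrite lerBlDr lerDl exprn_ge0.
    by move=> i _; exact: root_prob_pow_conv.
  - have h : (1 - u ^+ N) / (1 - u) @[N --> \oo] --> (1 - 0) * (1 - u)^-1.
      by apply: cvgM; [apply: cvgB => //|]; exact: cvg_cst.
    by rewrite subr0 mul1r in h.
  - exact: cvg_cst.
have h : A N * B N / B N * (1 - u) @[N --> \oo] -->
    (1 - u)^-1 * (1 - ln (1 - u))^-1 * (1 - u).
  by apply: cvgM; [apply: cvgM => //; exact: cvgV|exact: cvg_cst].
have E : (1 - u)^-1 * (1 - ln (1 - u))^-1 * (1 - u) = 1 / (1 - ln (1 - u)).
  by rewrite mulrAC mulVf ?lt0r_neq0.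
rewrite -E; apply: cvg_trans h; apply: near_eq_cvg; near=> N.
have BN0 : B N != 0 by near: N; exact: cvgr_neq0 cB ln1.
by rewrite /= mulfK // mulr_suml.
Unshelve. all: by end_near. Qed.

(** * The Euler-Gompertz constant as a series, and the error term *)

Local Notation a k := (q k / (k.+1%:R * k.+2%:R)).

Lemma inv_succ_mul (k : nat) : (k.+1%:R * k.+2%:R)^-1 = k.+1%:R^-1 - k.+2%:R^-1 :> R.
Proof.
rewrite -[k.+2]addn1 -[k.+1]addn1 !natrD.
by field; rewrite !natr1 !pnatr_eq0.
Qed.

(** The weights telescope: from [m] on they add up to less than [1 / (m + 1)]. *)
Lemma sum_root_prob_le (c : R) m N : (m <= N)%N ->
  (forall k, (m <= k)%N -> q k <= c) ->
  \sum_(m <= k < N) a k <= c / m.+1%:R.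
Proof.
move=> mN hc; have c0 : 0 <= c by apply: le_trans (hc m _); rewrite ?root_prob_ge0.
apply: (@le_trans _ _ (c * (m.+1%:R^-1 - N.+1%:R^-1))).
  rewrite -opprB -(telescope_sumr (fun k => k.+1%:R^-1 : R)) // -sumrN mulr_sumr.
  apply: ler_sum_nat => k /andP[mk _]; rewrite opprB inv_succ_mul ler_wpM2r ?hc //.
  by rewrite -inv_succ_mul invr_ge0 mulr_ge0.
by rewrite ler_wpM2l // lerBlDr lerDl invr_ge0.
Qed.

(** This is the beta value [B (k + 1, 2) = k! / (k + 2)!]; the endpoint 1 has measure zero. *)
Lemma integral_beta (k : nat) :
  (\int[lebesgue_measure]_(x in `[0%R, 1%R[) (x ^+ k * (1 - x))%:E
    = (k.+1%:R * k.+2%:R)^-1%:E :> \bar R)%E.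
Proof.
have := EFin_beta_fun (R := R) k.+1 2; rewrite beta_funE /= addn2 /=.
rewrite (_ : _ / _ = (k.+1%:R * k.+2%:R)^-1); last first.
  rewrite mulr1 !factS mulnA !natrM.
  by rewrite invfM mulrCA divff ?mulr1 ?pnatr_eq0 -?lt0n ?fact_gt0 // mulrC.
move=> ->; rewrite integral_itv_bndo_bndc; last first.
  by apply/measurable_EFinP; exact: (measurable_XMonemX k 1).
rewrite integral_mkcond; apply: eq_integral => x _.
by rewrite !patchE; case: ifP.
Qed.

Lemma cvg_root_prob_sum : \sum_(k < N) a k @[N --> \oo] --> euler_gompertz R.
Proof.
have a0 k : 0 <= a k by rewrite divr_ge0 ?root_prob_ge0 ?mulr_ge0.
pose s N := \sum_(0 <= k < N) a k.
(* The real limit must exist before it can be compared with the series in the extended reals. *)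
have cs : cvgn s.
  apply: (nondecreasing_is_cvgn (u_ := s)).
    by move=> m n mn; rewrite /s (big_cat_nat _ mn) //= lerDl sumr_ge0.
  exists 1 => _ [N _ <-]; have := @sum_root_prob_le 1 0 N (leq0n _).
  by rewrite divr1; apply=> k _; exact: root_prob_le1.
under eq_fun do rewrite -(big_mkord xpredT (fun k => a k)).
suff -> : euler_gompertz R = limn s by [].
rewrite /euler_gompertz /Rintegral.
have mD : measurable (`[0%R, 1%R[%classic : set R) by exact: measurable_itv.
pose f k (x : R) : \bar R := (q k * x ^+ k * (1 - x))%:E.
have -> : (\int[lebesgue_measure]_(x in `[0%R, 1%R[) (1 / (1 - ln (1 - x)))%:E =
   \int[lebesgue_measure]_(x in `[0%R, 1%R[) \sum_(0 <= k <oo) f k x)%E.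
  apply: eq_integral => x; rewrite inE /= in_itv /= => x01.
  apply/esym/cvg_lim => //; under eq_fun do rewrite /f sumEFin.
  apply: cvg_EFin; first exact: nearW.
  have := cvg_root_prob_series x01; apply: cvg_trans; apply: near_eq_cvg.
  by near=> N; rewrite /= big_mkord.
(* The terms are nonnegative on [[0, 1[], so sum and integral may be exchanged. *)
rewrite integral_nneseries //; last 2 first.
- move=> k; apply/measurable_EFinP.
  rewrite (_ : (fun x => _) = (fun x => q k * XMonemX k 1 x)).
    by apply: measurable_funM => //; exact: measurable_XMonemX.
  by apply/funext => x; rewrite -mulrA.
- move=> k x /=; rewrite in_itv /= => /andP[x0 x1]; rewrite lee_fin.
  apply: mulr_ge0; last by rewrite subr_ge0 ltW.
  by rewrite mulr_ge0 ?root_prob_ge0 ?exprn_ge0.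
have -> : (\sum_(0 <= k <oo) \int[lebesgue_measure]_(x in `[0%R, 1%R[) f k x =
   \sum_(0 <= k <oo) (a k)%:E)%E.
  apply: eq_eseriesr => k _; rewrite EFinM -integral_beta -ge0_integralZl_EFin //.
  - by apply: eq_integral => x _; rewrite /f -mulrA EFinM.
  - move=> x /=; rewrite in_itv /= => /andP[x0 x1]; rewrite lee_fin.
    by rewrite mulr_ge0 ?exprn_ge0 // subr_ge0 ltW.
  - by apply/measurable_EFinP; exact: (measurable_XMonemX k 1).
  - exact: root_prob_ge0.
rewrite (_ : (\sum_(0 <= k <oo) (a k)%:E)%E = (limn s)%:E) //.
apply/cvg_lim => //; under eq_fun do rewrite sumEFin.
by apply: cvg_EFin; [exact: nearW|].
Unshelve. all: by end_near. Qed.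

Lemma mean_surplus_bound m : (1 < m)%N ->
  `|mean_surplus R m - (2 * euler_gompertz R - 1) * m.+1%:R| <= 8 / ln m.+1%:R.
Proof.
move=> m1; set G := euler_gompertz R; set l := ln _.
have l0 : 0 < l by apply: ln_gt0; rewrite ltr1n ltnS ltnW.
have qk k : (m <= k)%N -> q k <= 4 / l.
  move=> mk; have k0 : 0 < k%:R :> R by rewrite ltr0n (leq_trans _ mk) // ltnW.
  (* [m + 1 <= k ^ 2] because [1 < m <= k]; this trades [ln k] for [l] at the cost of a factor 2. *)
  have hl : l <= 2 * ln k%:R.
    have -> : 2 * ln k%:R = ln (k ^ 2)%:R :> R by rewrite natrX lnXn // mulr_natl.
    by rewrite ler_ln ?posrE ?ltr0n ?ler_nat //; nia.
  rewrite ler_pdivlMr // (le_trans (ler_wpM2l (root_prob_ge0 _ _) hl)) //.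
  have := root_prob_ln k; lra.
pose s N := \sum_(k < N) a k.
have a0 k : 0 <= a k by rewrite divr_ge0 ?root_prob_ge0 ?mulr_ge0.
have sD N : (m <= N)%N -> s N = s m + \sum_(m <= k < N) a k.
  by move=> mN; rewrite /s -!(big_mkord xpredT (fun k => a k)) -big_cat_nat.
have h1 : s m <= G.
  apply: (cvgr_to_ge cvg_root_prob_sum); near=> N.
  have mN : (m <= N)%N by near: N; exact: nbhs_infty_ge.
  by rewrite -/(s N) (sD _ mN) lerDl sumr_ge0.
have h2 : G <= s m + 4 / l / m.+1%:R.
  apply: (cvgr_to_le cvg_root_prob_sum); near=> N.
  have mN : (m <= N)%N by near: N; exact: nbhs_infty_ge.
  by rewrite -/(s N) (sD _ mN) lerD2l sum_root_prob_le.
have M0 : 0 < m.+1%:R :> R by rewrite ltr0n.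
have {}h2 : m.+1%:R * (G - s m) <= 4 / l.
  by rewrite mulrC -ler_pdivlMr // lerBlDl.
have {}h1 : 0 <= m.+1%:R * (G - s m) by rewrite mulr_ge0 ?subr_ge0 // ltW.
rewrite mean_surplusE -/(s m).
have -> : 2 * q m - m.+1%:R + 2 * m.+1%:R * s m - (2 * G - 1) * m.+1%:R =
  2 * q m - 2 * (m.+1%:R * (G - s m)) by ring.
have q0 := root_prob_ge0 R m; have qm := qk m (leqnn _).
have -> : 8 / l = 2 * (4 / l) by field; rewrite lt0r_neq0.
(* Both [q m] and [(m + 1) (G - s m)] lie in [[0, 4 / l]], so twice their difference is at most
   [8 / l] in absolute value. *)
rewrite ler_norml; lra.
Unshelve. all: by end_near. Qed.

End RootProbability.

Theorem proposition4p3 (R : realType) :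
  (fun n : nat => mean_N0 R n) =
  (fun n : nat => (2 * euler_gompertz R - 1) * n%:R)
  +O_ \oo (fun n : nat => 1 / ln n%:R).
Proof.
apply/eqaddOP; near=> C.
have C8 : 8 <= C by near: C; exact: nbhs_pinfty_ge.
(* With [n = m + 1] vertices, [n >= 3] is the condition [1 < m] of the bound. *)
exists 3%N => // -[|m] //= m1.
have l0 : 0 < ln m.+1%:R :> R by apply: ln_gt0; rewrite ltr1n ltnW.
have := mean_surplus_bound R m1; rewrite -mean_N0E => /le_trans; apply.
have li0 : 0 <= (ln m.+1%:R)^-1 :> R by rewrite invr_ge0 ltW.
by rewrite div1r ger0_norm // ler_wpM2r.
Unshelve. all: by end_near. Qed.
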